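(* For every integer $m\ge 1$, with $q=2^m$, and every $d\in\{6,8,10\}$, \[ \alpha_q(d)=\frac1q\left[\binom{q+d-1}{d}+(q-1)\binom{q/2+d/2-1}{d/2}\right]. \]
   Context: For integers $q\ge 2$, $d\ge 0$, let $\Delta_q(d)=\{a\in\mathbb Z_{\ge0}^q:\sum_{i=1}^q a_i=d\}$, and let $e_1,\dots,e_q$ be the standard unit vectors of $\mathbb Z^q$. The graph $G_q(d)$ has vertex set $\Delta_q(d)$; distinct $a,b\in\Delta_q(d)$ are adjacent exactly when $a-b=e_i-e_j$ for some $i\ne j$. Write $\alpha_q(d)=\alpha(G_q(d))$ for its independence number. *)

(* Defs.v *)
From mathcomp Require Import all_boot all_order all_algebra.
Set Implicit Arguments.
Unset Strict Implicit.
Unset Printing Implicit Defensive.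
Import GRing.Theory.

Definition independent (V : finType) (e : rel V) (S : {set V}) : bool :=
  [forall x in S, forall y in S, ~~ e x y].

Definition independence_number (V : finType) (e : rel V) : nat :=
  \max_(S : {set V} | independent e S) #|S|.

(* A coordinate of a point whose coordinates sum to d is at most d, so bounding
   the coordinates by d loses no point and makes the vertex set a finType. *)
Definition Delta (q d : nat) : finType :=
  {a : {ffun 'I_q -> 'I_d.+1} | \sum_(i < q) (a i : nat) == d}.

Definition vec (q d : nat) (a : Delta q d) : 'rV[int]_q :=
  (\row_(k < q) ((val a k : nat)%:Z))%R.

(* delta_mx 0 i is the standard unit vector e_i of Z^q. *)
Definition adj (q d : nat) : rel (Delta q d) := fun a b =>
  (a != b) &&
  [exists i : 'I_q, exists j : 'I_q,
    (i != j) && (vec a - vec b == delta_mx 0 i - delta_mx 0 j)%R].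

Definition alpha (q d : nat) : nat := independence_number (@adj q d).

(* Main.v *)
(* Let V = F_2^m and fix a bijection v from the coordinates to V.  The code
   C = {a : sum a_i v_i = 0} is independent, and for b of degree d - 1 the clique
   {b + e_i} meets C exactly once.  For d = 6, 8, 10 the linear program dual to
   fractional clique covering has a solution w, invariant under permuting the
   coordinates and independent of q, supported on these cliques alone: the total
   weight of the cliques through a is 1 unless a has exactly two odd entries, and
   then it is at least 1.  No point of C has exactly two odd entries, since
   v_i + v_j = 0 forces i = j; double counting then gives |S| <= |C| for every
   independent S.  The size of C comes from summing over the characters of V: the
   trivial one contributes the coefficient of t^d in (1 - t)^(-q), and each of the
   q - 1 others takes the values 1 and -1 equally often and contributes the
   coefficient in (1 - t^2)^(-q/2). *)
From Stdlib Require Import BinNat Nnat.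
Require Import Defs.
From mathcomp Require Import all_boot all_order all_algebra.
Import GRing.Theory Num.Theory.

(** * Double counting with weighted cliques *)

(** Counting weighted incidences gives D|S| <= sum_k w_k |S meets k| <= sum_k w_k = D|C|. *)
Lemma card_le_exact_cover {T K I : finType} (c : K -> I -> T) (w : K -> nat)
    (D : nat) (S C : {set T}) :
  0 < D ->
  (forall k, #|[set i | c k i \in S]| <= 1) ->
  (forall k, #|[set i | c k i \in C]| = 1) ->
  (forall a, a \in S -> D <= \sum_k \sum_(i | c k i == a) w k) ->
  (forall a, a \in C -> \sum_k \sum_(i | c k i == a) w k = D) ->
  #|S| <= #|C|.
Proof.
move=> D0 hS hC geD eqD.
have swap (A : {set T}) : \sum_(a in A) \sum_k \sum_(i | c k i == a) w k =
    \sum_k #|[set i | c k i \in A]| * w k.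
  rewrite exchange_big; apply: eq_bigr => k _ /=.
  rewrite -sum_nat_const (exchange_big_dep predT) //=.
  rewrite [RHS](eq_bigl (fun i => c k i \in A)) => [|i]; last by rewrite inE.
  rewrite [RHS]big_mkcond; apply: eq_bigr => i _.
  have e a : (a \in A) && (c k i == a) = (c k i \in A) && (a == c k i).
    by rewrite eq_sym; case: eqP => [->|]; rewrite ?andbT ?andbF.
  by rewrite (eq_bigl _ _ e); case: (c k i \in A); rewrite ?big_pred1_eq ?big_pred0_eq.
rewrite -(leq_pmul2r D0) -!sum_nat_const.
apply: leq_trans (leq_sum _ geD) _.
rewrite -[leqRHS](eq_bigr _ eqD) !swap; apply: leq_sum => k _.
by rewrite hC leq_mul2r hS orbT.
Qed.

(** * Points of the simplex and the cliques b + e_i *)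

Lemma point_subproof {q d : nat} {f : 'I_q -> nat} : \sum_i f i = d ->
  \sum_(i < q) ([ffun i => inord (f i)] : {ffun 'I_q -> 'I_d.+1}) i == d.
Proof.
move=> fd; rewrite -[eqbRHS]fd; apply/eqP/eq_bigr => i _.
by rewrite ffunE inordK // ltnS -fd (bigD1 i) //= leq_addr.
Qed.

Definition point {q d : nat} {f : 'I_q -> nat} (fd : \sum_i f i = d) : Delta q d :=
  exist (fun a : {ffun 'I_q -> 'I_d.+1} => \sum_(i < q) (a i : nat) == d) _
    (point_subproof fd).

Lemma pointE {q d : nat} {f : 'I_q -> nat} (fd : \sum_i f i = d) i :
  val (point fd) i = f i :> nat.
Proof. by rewrite /= ffunE inordK // ltnS -fd (bigD1 i) //= leq_addr. Qed.

Lemma Delta_sum {q d : nat} (a : Delta q d) : \sum_i (val a i : nat) = d.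
Proof. exact/eqP/(valP a). Qed.

Lemma Delta_inj {q d : nat} (a b : Delta q d) :
  (forall i, val a i = val b i :> nat) -> a = b.
Proof. by move=> ab; apply/val_inj/ffunP => i; apply: val_inj; exact: ab. Qed.

Lemma sum_pred1 {q : nat} (i : 'I_q) : \sum_j (i == j) = 1.
Proof. by rewrite (bigD1 i) //= eqxx big1 // => j /negPf; rewrite eq_sym => ->. Qed.

Lemma raise_subproof {q n : nat} (b : Delta q n) (i : 'I_q) :
  \sum_j (val b j + (i == j)) = n.+1.
Proof. by rewrite big_split /= Delta_sum sum_pred1 addn1. Qed.

(** For fixed [b], the points [raise b i] form the clique indexed by [b]. *)
Definition raise {q n : nat} (b : Delta q n) (i : 'I_q) : Delta q n.+1 :=
  point (raise_subproof b i).

Lemma raiseE {q n : nat} (b : Delta q n) i j :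
  val (raise b i) j = val b j + (i == j) :> nat.
Proof. exact: pointE. Qed.

Lemma raise_inj {q n : nat} (i : 'I_q) : injective (@raise q n ^~ i).
Proof.
move=> b b' e; apply: Delta_inj => j; apply: (@addIn (i == j)).
by rewrite -!raiseE e.
Qed.

Lemma raise_onto {q n : nat} (a : Delta q n.+1) (i : 'I_q) :
  0 < val a i -> exists b, raise b i = a.
Proof.
move=> ai.
have lt j : (i == j) <= val a j by case: eqP => [<-|].
have bd : \sum_j (val a j - (i == j)) = n.
  apply: (@addIn 1); rewrite -[in LHS](sum_pred1 i) -big_split /= addn1.
  by rewrite -[RHS](Delta_sum a); apply: eq_bigr => j _; rewrite subnK.
exists (point bd); apply: Delta_inj => j.
by rewrite raiseE pointE subnK.
Qed.

Lemma raise_adj {q n : nat} (b : Delta q n) (i j : 'I_q) :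
  i != j -> adj (raise b i) (raise b j).
Proof.
move=> ij; apply/andP; split.
  apply/eqP => /(congr1 (fun a : Delta q n.+1 => val a i : nat)).
  by rewrite !raiseE eqxx eq_sym (negPf ij) => /eqP; rewrite eqn_add2l.
apply/existsP; exists i; apply/existsP; exists j; rewrite ij /=.
apply/eqP/rowP => k; rewrite !mxE !raiseE eqxx /= ![k == _]eq_sym.
by rewrite !PoszD opprD addrACA subrr add0r !natz.
Qed.

(** * Entries of a point up to permutation *)

Definition values {q d : nat} (a : Delta q d) : seq nat :=
  [seq (val a i : nat) | i <- enum 'I_q].

Lemma big_values {q d : nat} (a : Delta q d) (R : Type) (idx : R) (op : Monoid.com_law idx)
    (P : pred nat) (F : nat -> R) :
  \big[op/idx]_(x <- values a | P x) F x = \big[op/idx]_(i | P (val a i)) F (val a i).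
Proof. by rewrite big_map big_enum_cond. Qed.

(** Lets the weight of the clique of [b] be read off the entries of any point on it, by decrementing
    one of them. *)
Lemma perm_values_raise {q n : nat} (b : Delta q n) (i : 'I_q) :
  perm_eq (values b) ((val b i : nat) :: rem (val (raise b i) i : nat) (values (raise b i))).
Proof.
have e : perm_eq (enum 'I_q) (i :: rem i (enum 'I_q)).
  by apply: perm_to_rem; rewrite mem_enum.
have eb := perm_map (fun j => val b j : nat) e.
have er := perm_map (fun j => val (raise b i) j : nat) e.
apply: (perm_trans eb); rewrite /= perm_cons perm_sym.
have mi : (val (raise b i) i : nat) \in values (raise b i).
  by apply: map_f; rewrite mem_enum.
have := perm_trans (etrans (perm_sym _ _) (perm_to_rem mi)) er.
rewrite /= perm_cons => /perm_trans; apply.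
have /eq_in_map -> // : {in rem i (enum 'I_q),
    (fun j => val (raise b i) j : nat) =1 (fun j => val b j : nat)}.
move=> j; rewrite (rem_filter _ (enum_uniq _)) mem_filter /= => /andP[ji _].
by rewrite raiseE eq_sym (negPf ji) addn0.
Qed.

(** Encodes an orbit under permuting coordinates as a partition; dropping the zeros removes the
    dependence on [q]. *)
Definition profile (s : seq nat) : seq nat := sort geq [seq x <- s | 0 < x].

Lemma perm_profile {s t : seq nat} : perm_eq s t -> profile s = profile t.
Proof.
have gtr : transitive geq by move=> y x z xy /leq_trans; apply.
have gan : antisymmetric geq by move=> x y; rewrite andbC => /anti_leq.
by move=> st; apply/perm_sortP => //; [move=> x y; exact: leq_total | exact: perm_filter].
Qed.

Lemma perm_profile_filter (s : seq nat) : perm_eq (profile s) [seq x <- s | 0 < x].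
Proof. by rewrite perm_sort. Qed.

(** Removing a positive entry commutes with discarding zeros and sorting, so neighbouring cliques
    can be found from the partition alone. *)
Lemma profile_rem (x y : nat) (s : seq nat) : 0 < x -> x \in s ->
  profile (y :: rem x s) = profile (y :: rem x (profile s)).
Proof.
move=> x0 xs.
have pr : perm_eq [seq z <- rem x s | 0 < z] (rem x (profile s)).
  rewrite -(perm_cons x) perm_sym.
  have xS : x \in profile s by rewrite (perm_mem (perm_profile_filter s)) mem_filter x0.
  apply: (perm_trans (etrans (perm_sym _ _) (perm_to_rem xS))).
  apply: (perm_trans (perm_profile_filter s)).
  by have := perm_filter (fun z => 0 < z) (perm_to_rem xs); rewrite /= x0.
transitivity (profile (y :: [seq z <- rem x s | 0 < z])).
  by rewrite /profile /= filter_id.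
by apply: perm_profile; rewrite perm_cons.
Qed.

(** * The linear program on partitions *)

(** A partition absent from the table gets the default weight 0. *)
Definition weight (tbl : seq (seq nat * N)) (s : seq nat) : N :=
  (nth ([::], 0%num) tbl (find (fun p => p.1 == profile s) tbl)).2.

(* Here s lists the nonzero entries of a point a; the cliques {b + e_i} through a
   are those of the b obtained by decrementing one of these entries. *)
Definition lower_weight (tbl : seq (seq nat * N)) (s : seq nat) : N :=
  foldr N.add 0%num [seq weight tbl (x.-1 :: rem x s) | x <- s].

Definition dominated (D : N) (tbl : seq (seq nat * N)) (s : seq nat) : bool :=
  if count odd s == 2 then N.leb D (lower_weight tbl s) else lower_weight tbl s == D.

(** [k] bounds the largest part; [fuel] makes the recursion on [n - x] structural and suffices once
    it is at least [n]. *)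
Fixpoint partitions (fuel n k : nat) : seq (seq nat) :=
  if fuel isn't f.+1 then [:: [::]] else
  if n is 0 then [:: [::]] else
  flatten [seq [seq x :: s | s <- partitions f (n - x) x] | x <- iota 1 (minn n k)].

Lemma mem_partitions f n k s : n <= f -> path geq k s -> all (ltn 0) s ->
  sumn s = n -> s \in partitions f n k.
Proof.
elim: f n k s => [|f IH] n k [|x s] nf /=
  => [|/andP[kx ps] /andP[x0 s0] sn||/andP[kx ps] /andP[x0 s0] sn] //.
- by move: nf; rewrite -sn; case: x x0 {kx ps sn}.
- by move=> _ _ <-.
case: n nf sn => [|n] nf sn; first by move: sn x0; case: x {kx ps}.
apply/flatten_mapP; exists x.
  by rewrite mem_iota x0 add1n ltnS leq_min kx andbT -sn leq_addr.
apply/map_f/IH => //; last by rewrite -sn addKn.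
by rewrite leq_subLR (leq_trans nf) // -add1n leq_add2r.
Qed.

Lemma profile_in_partitions n s : sumn s = n -> profile s \in partitions n n n.
Proof.
move=> sn.
have pf := perm_profile_filter s.
have ss : sumn (profile s) = n.
  rewrite -sn (perm_sumn pf) !sumnE big_filter [RHS](bigID (leq 1)) /=.
  by rewrite [X in _ + X]big1 ?addn0 // => i; rewrite -leqNgt leqn0 => /eqP.
apply: mem_partitions => //.
  have : sorted geq (profile s) by apply: sort_sorted => x y; exact: leq_total.
  move: ss; case: (profile s) => //= x t <- ->.
  by rewrite /geq /= leq_addr.
by rewrite (perm_all _ pf) filter_all.
Qed.

(** For each [i] with a_i > 0 exactly one [b] has [raise b i = a], and for other [i] none; a sum
    depending on [q] thus becomes a sum over the parts of a partition. *)
Lemma sum_weight_cliques (tbl : seq (seq nat * N)) {q n : nat} (a : Delta q n.+1) :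
  \sum_(b : Delta q n) \sum_(i | raise b i == a) N.to_nat (weight tbl (values b)) =
  N.to_nat (lower_weight tbl (profile (values a))).
Proof.
pose g x := N.to_nat (weight tbl (x.-1 :: rem x (profile (values a)))).
transitivity (\sum_(x <- profile (values a)) g x); last first.
  (* Only the list being traversed is generalized; the list from which [rem] deletes stays the full
     profile. *)
  rewrite /lower_weight; elim: {1 3}(profile _) => [|x s IH]; first by rewrite big_nil.
  by rewrite big_cons /= N2Nat.inj_add IH.
rewrite (perm_big _ (perm_profile_filter _)) big_filter big_values.
rewrite (exchange_big_dep predT) //= [RHS]big_mkcond; apply: eq_bigr => i _ /=.
case: ifP => [/raise_onto[b ba]|ai]; last first.
  rewrite big_pred0 // => b; apply/eqP => ba; move: ai.
  by rewrite -ba raiseE eqxx addn1.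
rewrite (big_pred1 b) => [|b']; last first.
  by apply/eqP/eqP => [|->//]; rewrite -ba => /raise_inj.
rewrite /g -ba raiseE eqxx addn1 /=; congr (N.to_nat _.2).
rewrite /weight (perm_profile (perm_values_raise b i)) raiseE eqxx addn1.
rewrite -profile_rem //; apply/mapP; exists i; first by rewrite mem_enum.
by rewrite raiseE eqxx addn1.
Qed.

(* The tables solve the linear program, scaled to the integer totals 72, 5760 and
   604800 respectively. *)
Definition table5 : seq (seq nat * N) :=
  [:: ([:: 5], 72%num); ([:: 4; 1], 36%num); ([:: 3; 2], 36%num);
     ([:: 3; 1; 1], 19%num); ([:: 2; 2; 1], 24%num); ([:: 2; 1; 1; 1], 15%num);
     ([:: 1; 1; 1; 1; 1], 12%num)].

Definition table7 : seq (seq nat * N) :=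
  [:: ([:: 7], 5760%num); ([:: 6; 1], 2880%num); ([:: 5; 2], 2880%num);
     ([:: 5; 1; 1], 1522%num); ([:: 4; 3], 2880%num); ([:: 4; 2; 1], 1847%num);
     ([:: 4; 1; 1; 1], 1194%num); ([:: 3; 3; 1], 1628%num);
     ([:: 3; 2; 2], 2066%num); ([:: 3; 2; 1; 1], 1252%num);
     ([:: 3; 1; 1; 1; 1], 984%num); ([:: 2; 2; 2; 1], 1440%num);
     ([:: 2; 2; 1; 1; 1], 1020%num); ([:: 2; 1; 1; 1; 1; 1], 840%num);
     ([:: 1; 1; 1; 1; 1; 1; 1], 720%num)].

Definition table9 : seq (seq nat * N) :=
  [:: ([:: 9], 604800%num); ([:: 8; 1], 302400%num); ([:: 7; 2], 302400%num);
     ([:: 7; 1; 1], 159813%num); ([:: 6; 3], 302400%num);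
     ([:: 6; 2; 1], 189573%num); ([:: 6; 1; 1; 1], 125361%num);
     ([:: 5; 4], 302400%num); ([:: 5; 3; 1], 171291%num);
     ([:: 5; 2; 2], 225654%num); ([:: 5; 2; 1; 1], 131583%num);
     ([:: 5; 1; 1; 1; 1], 103356%num); ([:: 4; 4; 1], 189090%num);
     ([:: 4; 3; 2], 207855%num); ([:: 4; 3; 1; 1], 130635%num);
     ([:: 4; 2; 2; 1], 146990%num); ([:: 4; 2; 1; 1; 1], 106695%num);
     ([:: 4; 1; 1; 1; 1; 1], 88020%num); ([:: 3; 3; 3], 189090%num);
     ([:: 3; 3; 2; 1], 138570%num); ([:: 3; 3; 1; 1; 1], 106200%num);
     ([:: 3; 2; 2; 2], 163830%num); ([:: 3; 2; 2; 1; 1], 110730%num);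
     ([:: 3; 2; 1; 1; 1; 1], 90000%num); ([:: 3; 1; 1; 1; 1; 1; 1], 76680%num);
     ([:: 2; 2; 2; 2; 1], 120960%num); ([:: 2; 2; 2; 1; 1; 1], 92610%num);
     ([:: 2; 2; 1; 1; 1; 1; 1], 78120%num);
     ([:: 2; 1; 1; 1; 1; 1; 1; 1], 68040%num);
     ([:: 1; 1; 1; 1; 1; 1; 1; 1; 1], 60480%num)].

(** Checking the finitely many partitions settles every [q] at once; weights in [N] keep the
    computation binary. *)
Lemma table5_dominated : all (dominated 72%num table5) (partitions 6 6 6).
Proof. by vm_compute. Qed.

Lemma table7_dominated : all (dominated 5760%num table7) (partitions 8 8 8).
Proof. by vm_compute. Qed.

Lemma table9_dominated : all (dominated 604800%num table9) (partitions 10 10 10).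
Proof. by vm_compute. Qed.

(** * Generating functions over the simplex *)

Definition trunc_geom {R : nzRingType} (d : nat) (x : R) : {poly R} :=
  (\poly_(k < d.+1) x ^+ k)%R.

(** Expanding the product runs over all exponent vectors bounded by [d], and the coefficient of
    degree [d] selects those of sum [d]. *)
Lemma sum_Delta_monomials {R : comNzRingType} (q d : nat) (x : 'I_q -> R) :
  (\sum_(a : Delta q d) \prod_i x i ^+ val a i = (\prod_i trunc_geom d (x i))`_d)%R.
Proof.
rewrite (eq_bigr _ (fun i _ => poly_def _ _)) bigA_distr_bigA coef_sum.
transitivity (\sum_(f : {ffun 'I_q -> 'I_d.+1} | (\sum_i (f i : nat)) == d)
   \prod_i x i ^+ f i)%R.
  rewrite [RHS](reindex_omap (val : Delta q d -> _) insub) => [|f fd]; last first.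
    by rewrite insubT.
  by apply: eq_bigl => a; rewrite valK eqxx (valP a).
rewrite big_mkcond; apply: eq_bigr => f _ /=.
rewrite (eq_bigr _ (fun i _ => esym (mul_polyC _ _))) big_split /=.
rewrite -rmorph_prod /= -expr_sum coefCM coefXn eq_sym.
by case: eqP; rewrite ?mulr1 ?mulr0.
Qed.

(** [Q] agrees with 1/(1 - t^r) up to degree [d], so (1 - t^r)Q is 1 there. The resulting recurrence
    for the coefficients of the powers of [Q] is Pascal's rule. *)
Lemma coef_exp_spaced {R : comNzRingType} {r d : nat} (p : nat) {Q : {poly R}} :
  0 < r -> (forall j, j <= d -> (Q`_j = (r %| j)%:R)%R) ->
  forall j, j <= d -> ((Q ^+ p)`_j = ((r %| j) * 'C(p + j %/ r - 1, j %/ r))%N%:R)%R.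
Proof.
move=> r0 hQ.
pose P : {poly R} := ((1 - 'X^r) * Q)%R.
have hP j : j <= d -> (P`_j = (j == 0)%:R)%R.
  move=> jd; rewrite /P mulrBl mul1r coefB coefXnM hQ //.
  case: ltnP => [jr|rj].
    rewrite subr0; case: j jr {jd} => [|j] jr; first by rewrite dvdn0.
    by rewrite gtnNdvd.
  rewrite hQ ?(leq_trans (leq_subr _ _)) // dvdn_subl // subrr.
  by case: j rj {jd} => //; rewrite leqNgt r0.
have rec t j : j <= d -> ((Q ^+ t.+1)`_j = (Q ^+ t)`_j +
    (if (j < r)%N then 0 else (Q ^+ t.+1)`_(j - r)%N))%R.
  move=> jd; have -> : ((Q ^+ t)`_j = (P * Q ^+ t)`_j)%R.
    rewrite coefM big_ord_recl /= hP // mul1r subn0 big1 ?addr0 // => i _.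
    by rewrite hP ?mul0r //; exact: leq_trans (ltn_ord i) jd.
  by rewrite /P -mulrA -exprS mulrBl mul1r coefB coefXnM subrK.
(* With exponent 0 the truncated subtraction still gives the right values: C(0, 0) = 1 and C(k - 1,
   k) = 0 for k > 0. *)
elim: p => [|p IH] j.
  move=> jd; rewrite expr0 coef1 add0n; case: j {jd} => [|j]; first by rewrite dvdn0 div0n.
  case: (boolP (r %| j.+1)) => //= /dvdnP[[|k] // ->].
  by rewrite mulnK // subn1 bin_small.
elim/ltn_ind: j => j IHj jd; rewrite rec // IH //.
case: ltnP => [jr|rj].
  rewrite addr0; case: j jr {IHj jd} => [|j] jr; first by rewrite div0n !bin0.
  by rewrite gtnNdvd.
rewrite IHj ?(leq_trans (leq_subr _ _)) //; last first.
  by rewrite ltn_subrL r0 (leq_trans r0 rj).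
rewrite dvdn_subl // -natrD -mulnDr; congr (_ * _)%:R%R.
have -> : j %/ r = ((j - r) %/ r).+1 by rewrite -{1}(subnK rj) divnDr // divnn r0 addn1.
by rewrite !addnS addSn !subn1 /= binS.
Qed.

Lemma card_Delta (q d : nat) : #|Delta q d| = 'C(q + d - 1, d).
Proof.
have sum1 : (\sum_(a : Delta q d) \prod_(i < q) 1 ^+ val a i = #|Delta q d|%:R :> int)%R.
  rewrite -sumr_const; apply: eq_bigr => a _.
  by rewrite big1 // => i _; rewrite expr1n.
apply/eqP; rewrite -(eqr_nat int) -sum1 sum_Delta_monomials prodr_const card_ord.
rewrite (@coef_exp_spaced _ 1 d) // => [|j jd]; first by rewrite dvd1n mul1n divn1.
by rewrite coef_poly ltnS jd expr1n dvd1n.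
Qed.

Lemma prod_bool {R : comNzRingType} {I : finType} (b : I -> bool) (F : bool -> R) :
  (\prod_i F (b i) = F true ^+ #|b| * F false ^+ #|predC b|)%R.
Proof.
rewrite (bigID b) /= -!prodr_const; congr (_ * _)%R; apply: eq_bigr => i.
  by move=> ->.
by move=> /negPf ->.
Qed.

(** Half of the signs are -1, so the factors pair up as 1/((1 - t)(1 + t)) = 1/(1 - t^2). *)
Lemma sum_Delta_signs (q e : nat) (b : 'I_q -> bool) :
  (\sum_i (-1) ^+ b i = 0 :> int)%R ->
  (\sum_(a : Delta q e.*2) \prod_i ((-1) ^+ b i) ^+ val a i =
    'C(q %/ 2 + e - 1, e)%N%:R :> int)%R.
Proof.
move=> b0; rewrite sum_Delta_monomials.
have cb : #|b| = #|predC b|.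
  move: b0; rewrite (bigID b) /=.
  rewrite (eq_bigr (fun=> -1)%R) => [|i ->] //.
  rewrite [X in (_ + X)%R](eq_bigr (fun=> 1)%R) => [|i /negPf ->] //.
  by rewrite !sumr_const mulNrn addrC => /eqP; rewrite subr_eq0 eqr_nat => /eqP ->.
have cq : #|b| = q %/ 2.
  have eq2 : #|b| * 2 = q by rewrite muln2 -addnn {2}cb cardC card_ord.
  by rewrite -(mulnK #|b| (isT : 0 < 2)) eq2.
rewrite (prod_bool b (fun s => trunc_geom e.*2 ((-1) ^+ s)%R)) -cb -exprMn cq.
rewrite (@coef_exp_spaced _ 2 e.*2) // => [|j jd].
  by rewrite -muln2 dvdn_mull // mulnK // mul1n.
(* The coefficient is the alternating sum 1 - 1 + 1 - ... of j + 1 terms, which is 1 for even [j]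
   and 0 for odd [j]. *)
rewrite coefM (eq_bigr (fun i : 'I_j.+1 => (-1) ^+ i)%R) => [|i _]; last first.
  have ij : i <= e.*2 by apply: leq_trans jd; rewrite -ltnS.
  have jij : j - i <= e.*2 by apply: leq_trans jd; exact: leq_subr.
  by rewrite !coef_poly !ltnS ij jij expr1n mulr1.
rewrite dvdn2; elim: j {jd} => [|j IH]; first by rewrite big_ord1.
by rewrite big_ord_recr /= IH -signr_odd /=; case: (odd j).
Qed.

(** * Characters of F_2^m and the size of the code *)

(** [bool] with exclusive or and conjunction serves as F_2. *)
Definition chi {m : nat} (u v : 'rV[bool]_m) : int := ((-1) ^+ ((u *m v^T) 0 0 : bool))%R.

Lemma chiD {m : nat} (u : 'rV[bool]_m) : {morph chi u : v w / (v + w)%R >-> (v * w)%R}.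
Proof. by move=> v w; rewrite /chi linearD mulmxDr mxE signr_addb. Qed.

Lemma chiC {m : nat} (u v : 'rV[bool]_m) : chi u v = chi v u.
Proof. by rewrite /chi -[in LHS](trmxK u) -trmx_mul mxE. Qed.

Lemma chi0 {m : nat} (u : 'rV[bool]_m) : chi u 0%R = 1%R.
Proof. by rewrite /chi linear0 mulmx0 mxE. Qed.

Lemma sum_chi {m : nat} (v : 'rV[bool]_m) :
  (\sum_u chi u v = ((v == 0) * 2 ^ m)%:R)%R.
Proof.
have [->|] := eqVneq v 0%R.
  rewrite (eq_bigr (fun=> 1%R)) => [|u _]; last exact: chi0.
  by rewrite sumr_const card_mx card_bool !mul1n.
move=> /rV0Pn[k vk].
have dk : chi (delta_mx 0 k)%R v = (-1)%R.
  rewrite /chi -rowE mxE mxE; by case: (v _ _) vk.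
(* Translating [u] by a unit vector at a nonzero coordinate of [v] flips every sign. *)
set s := (\sum_u _)%R; have : (s = - s)%R.
  rewrite {1}/s (reindex_inj (addrI (delta_mx 0 k)%R)) /= -mulN1r mulr_sumr.
  by apply: eq_bigr => u _; rewrite chiC chiD !(chiC v) dk.
by move/eqP; rewrite -addr_eq0 -mulr2n mulrn_eq0 /= mul0n => /eqP.
Qed.

Definition syndrome {m q d : nat} (v : 'I_q -> 'rV[bool]_m) (a : Delta q d) : 'rV[bool]_m :=
  (\sum_i v i *+ val a i)%R.

Definition code {m q : nat} (d : nat) (v : 'I_q -> 'rV[bool]_m) : {set Delta q d} :=
  [set a | syndrome v a == 0%R].

Lemma card_code {m q : nat} (e : nat) (v : 'I_q -> 'rV[bool]_m) : bijective v ->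
  (q%:R * #|code e.*2 v|%:R = 'C(q + e.*2 - 1, e.*2)%:R +
    (q%:R - 1) * 'C(q %/ 2 + e - 1, e)%N%:R :> int)%R.
Proof.
move=> bv.
have cq : q = 2 ^ m by have := bij_eq_card bv; rewrite card_ord card_mx card_bool mul1n.
have chis u (a : Delta q e.*2) : (chi u (syndrome v a) = \prod_i chi u (v i) ^+ val a i)%R.
  rewrite /syndrome (big_morph _ (chiD u) (chi0 u)); apply: eq_bigr => i _.
  by elim: (val a i : nat) => [|k IH]; rewrite ?chi0 // mulrS exprS chiD IH.
transitivity (\sum_(a : Delta q e.*2) \sum_u chi u (syndrome v a))%R.
  rewrite (eq_bigr _ (fun a _ => sum_chi (syndrome v a))).
  rewrite -natr_sum -natrM; congr _%:R%R.
  rewrite -big_distrl /= mulnC; congr (_ * _) => //.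
  by rewrite -sum1_card big_mkcond; apply: eq_bigr => a _; rewrite inE; case: eqP.
rewrite exchange_big (bigD1 0%R) //=; congr (_ + _)%R.
  rewrite -card_Delta -sumr_const; apply: eq_bigr => a _.
  by rewrite chiC chi0.
rewrite (eq_bigr (fun=> 'C(q %/ 2 + e - 1, e)%N%:R%R)) => [|u u0]; last first.
  rewrite (eq_bigr _ (fun a _ => chis u a)) sum_Delta_signs //.
  (* As [v] is a bijection, orthogonality for u != 0 says that the signs are balanced. *)
  rewrite -(reindex v (P := predT) (F := chi u)) //=; last exact: onW_bij.
  by under eq_bigr => w _ do rewrite chiC; rewrite sum_chi (negPf u0).
rewrite sumr_const cardC1 card_mx card_bool mul1n -cq.
by rewrite -subn1 mulrnBr ?mulrBl ?mul1r ?mulr_natl // cq expn_gt0.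
Qed.

(** * The code against adjacency, cliques and parities *)

Lemma addvv {m : nat} (v : 'rV[bool]_m) : (v + v = 0)%R.
Proof. by apply/rowP => i; rewrite !mxE; case: (v _ _). Qed.

Lemma mulrn_odd {m : nat} (v : 'rV[bool]_m) (k : nat) : (v *+ k = v *+ odd k)%R.
Proof.
by rewrite -{1}(odd_double_half k) -addnn !mulrnDr addvv addr0.
Qed.

Lemma adj_coord {q d : nat} {a b : Delta q d} : adj a b -> exists i j : 'I_q,
  i != j /\ forall k, val a k + (j == k) = val b k + (i == k).
Proof.
move=> /andP[_ /existsP[i /existsP[j /andP[ij /eqP e]]]].
exists i, j; split=> // k; apply/eqP; rewrite -eqz_nat !PoszD.
move/rowP/(_ k): e; rewrite !mxE eqxx /= !natz ![k == _]eq_sym => /eqP.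
by rewrite subr_eq addrAC -subr_eq opprK => /eqP ->; rewrite addrC.
Qed.

Lemma sum_mulrn_pred1 {V : zmodType} {q : nat} (v : 'I_q -> V) (i : 'I_q) :
  (\sum_j v j *+ (i == j) = v i)%R.
Proof.
by rewrite (bigD1 i) //= eqxx big1 ?addr0 // => j; rewrite eq_sym => /negPf ->.
Qed.

Lemma syndrome_raise {m q n : nat} (v : 'I_q -> 'rV[bool]_m) (b : Delta q n) i :
  syndrome v (raise b i) = (syndrome v b + v i)%R.
Proof.
rewrite /syndrome (eq_bigr (fun j => v j *+ val b j + v j *+ (i == j))%R); last first.
  by move=> j _; rewrite raiseE mulrnDr.
by rewrite big_split /= sum_mulrn_pred1.
Qed.

(** Adjacency means a + e_j = b + e_i; two zero syndromes would then force v_j = v_i. *)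
Lemma code_independent {m q d : nat} (v : 'I_q -> 'rV[bool]_m) :
  injective v -> independent (@adj q d) (code d v).
Proof.
move=> vi; apply/forall_inP => a; rewrite inE => /eqP sa.
apply/forall_inP => b; rewrite inE => /eqP sb; apply/negP => /adj_coord[i [j [ij e]]].
move/negP: ij; apply; apply/eqP/vi.
have : (syndrome v a + v j = syndrome v b + v i)%R.
  rewrite -(sum_mulrn_pred1 v i) -(sum_mulrn_pred1 v j) -!big_split; apply: eq_bigr => k _ /=.
  by rewrite -!mulrnDr e.
by rewrite sa sb !add0r.
Qed.

(** Adding e_i shifts the syndrome by v_i, so the only valid [i] solves v_i = - syndrome of [b]. *)
Lemma code_meets_clique {m q n : nat} (v : 'I_q -> 'rV[bool]_m) (b : Delta q n) :
  bijective v -> #|[set i | raise b i \in code n.+1 v]| = 1.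
Proof.
move=> [g gK vK]; apply/eqP/cards1P; exists (g (- syndrome v b)%R).
apply/setP => i; rewrite !inE syndrome_raise addrC addr_eq0.
by apply/eqP/eqP => [<-|->]; rewrite ?gK ?vK.
Qed.

Lemma independent_meets_clique {q n : nat} (S : {set Delta q n.+1}) (b : Delta q n) :
  independent (@adj q n.+1) S -> #|[set i | raise b i \in S]| <= 1.
Proof.
move=> /forall_inP hS; apply/card_le1_eqP => j i; rewrite !inE => jS iS.
apply/eqP/negPn/negP => ij; move/forall_inP: (hS _ iS) => /(_ _ jS)/negP; apply.
exact: raise_adj.
Qed.

Lemma rV_bool_eq {m : nat} (v w : 'rV[bool]_m) : (v + w = 0)%R -> v = w.
Proof. by move/eqP; rewrite addr_eq0 => /eqP ->; apply/eqP; rewrite eq_sym -addr_eq0 addvv. Qed.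

(** The syndrome sees only parities: odd entries at exactly [i] and [j] would give v_i + v_j = 0. *)
Lemma code_odd_count {m q d : nat} (v : 'I_q -> 'rV[bool]_m) (a : Delta q d) :
  injective v -> a \in code d v -> count odd (profile (values a)) != 2.
Proof.
move=> vi; rewrite inE => /eqP sa.
rewrite (permP (perm_profile_filter _)) count_filter.
rewrite (@eq_count _ _ odd) => [|x] /=; last by case: x => //= x; rewrite andbT.
rewrite -sum1_count big_values; apply/eqP.
rewrite sum1dep_card => /eqP/cards2P[i [j [ij oij]]].
apply: (negP ij); apply/eqP/vi/rV_bool_eq.
rewrite -[RHS]sa /syndrome (eq_bigr _ (fun k _ => mulrn_odd _ _)).
have odd2 k : odd (val a k) = (k \in [set i; j]) by rewrite -oij inE.
under eq_bigr => k _ do rewrite odd2.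
rewrite (eq_bigr (fun k => if k \in [set i; j] then v k else 0))%R => [|k _]; last by case: ifP.
by rewrite -big_mkcond /= big_setU1 ?inE //= big_set1.
Qed.

(** * The independence number *)

Lemma alphaE {m q n : nat} (D : N) (tbl : seq (seq nat * N)) (v : 'I_q -> 'rV[bool]_m) :
  D != 0%num -> all (dominated D tbl) (partitions n.+1 n.+1 n.+1) -> bijective v ->
  alpha q n.+1 = #|code n.+1 v|.
Proof.
move=> D0 /allP dom bv; have vi := bij_inj bv.
have dom' (a : Delta q n.+1) : dominated D tbl (profile (values a)).
  by apply/dom/profile_in_partitions; rewrite sumnE big_values Delta_sum.
apply/eqP; rewrite eqn_leq; apply/andP; split; last first.
  exact: (leq_bigmax_cond (code n.+1 v) (code_independent v vi)).
apply/bigmax_leqP => S iS.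
pose w (b : Delta q n) := N.to_nat (weight tbl (values b)).
apply: (@card_le_exact_cover _ _ _ raise w (N.to_nat D)).
- by rewrite lt0n; apply: contraNneq D0 => D0; apply/eqP/N2Nat.inj.
- by move=> b; exact: independent_meets_clique.
- by move=> b; exact: code_meets_clique.
- move=> a _; rewrite sum_weight_cliques; have := dom' a; rewrite /dominated.
  (* The inequality passes from [N] to [nat] as the vanishing of a truncated difference. *)
  case: ifP => _ => [/N.leb_le/N.sub_0_le/(congr1 N.to_nat)|/eqP -> //].
  by rewrite N2Nat.inj_sub => /eqP.
- move=> a aC; rewrite sum_weight_cliques; have := dom' a; rewrite /dominated.
  by rewrite (negPf (code_odd_count v a vi aC)) => /eqP ->.
Qed.

Theorem theorem9p5 (m q d : nat) (hm : 1 <= m) (hq : q = 2 ^ m)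
    (hd : d \in [:: 6; 8; 10]) :
  ((alpha q d)%:R =
    (q%:R)^-1 *
      ('C(q + d - 1, d)%:R
       + (q%:R - 1) * 'C(q %/ 2 + d %/ 2 - 1, d %/ 2)%:R) :> rat)%R.
Proof.
have cV : q = #|{: 'rV[bool]_m}| by rewrite card_mx card_bool mul1n.
pose v (i : 'I_q) : 'rV[bool]_m := enum_val (cast_ord cV i).
have bv : bijective v.
  exists (fun u => cast_ord (esym cV) (enum_rank u)) => u.
    by rewrite /v enum_valK cast_ordK.
  by rewrite /v cast_ordKV enum_rankK.
have alphaC : alpha q d = #|code d v|.
  move: hd; rewrite !inE => /or3P[] /eqP ->.
  - exact: (alphaE _ _ v _ table5_dominated).
  - exact: (alphaE _ _ v _ table7_dominated).
  - exact: (alphaE _ _ v _ table9_dominated).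
have dE : d = (d %/ 2).*2 by move: hd; rewrite !inE => /or3P[] /eqP ->.
have q0 : (q%:R != 0 :> rat)%R by rewrite pnatr_eq0 hq -lt0n expn_gt0.
rewrite alphaC {hd alphaC}.
move: (d %/ 2) dE => e ->.
(* The integer count of q|C| is mapped into the rationals, where [q] can be cancelled. *)
have := card_code e v bv => /(congr1 (intr : int -> rat)).
rewrite !(rmorphD, rmorphM, rmorphB, rmorph1, rmorph_nat) /= => <-.
by rewrite mulKf.
Qed.
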